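(* Let $0<l_2\le l_1$ be real numbers. For any $\theta$ with $0<\theta<\pi$ there exists a unique triangle $ABC$ with $l_a=l_2$, $l_b=l_1$ and $\angle C=\theta$.
   Context: For a non-degenerate triangle $ABC$ in the Euclidean plane, $\angle A,\angle B,\angle C$ are its interior angles; $l_a$ and $l_b$ denote the lengths of the internal angle bisectors drawn from $A$ and $B$ respectively, measured from the vertex to the opposite side. Uniqueness of triangles is understood up to congruence respecting the vertex labels. *)

(* Defs.v *)
From Stdlib Require Import Reals Lra.
Open Scope R_scope.

Definition point : Type := (R * R)%type.

Definition distance (P Q : point) : R :=
  dist_euc (fst P) (snd P) (fst Q) (snd Q).

(* Scalar product of the vectors from V to P and from V to Q. *)
Definition dot (V P Q : point) : R :=
  (fst P - fst V) * (fst Q - fst V) + (snd P - snd V) * (snd Q - snd V).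

(* Unoriented angle PVQ with vertex V, in [0, PI]; meaningful only when
   P <> V and Q <> V. *)
Definition angle (P V Q : point) : R :=
  acos (dot V P Q / (distance V P * distance V Q)).

Definition collinear (A B C : point) : Prop :=
  exists a b c : R,
    (a <> 0 \/ b <> 0) /\
    a * fst A + b * snd A = c /\
    a * fst B + b * snd B = c /\
    a * fst C + b * snd C = c.

Record plane_triangle : Type := Triangle {
  vA : point;
  vB : point;
  vC : point;
  non_degenerate : ~ collinear vA vB vC
}.

Definition on_segment (P Q D : point) : Prop :=
  exists t : R, 0 <= t <= 1 /\
    D = ((1 - t) * fst P + t * fst Q, (1 - t) * snd P + t * snd Q).

(* D is the point where the internal bisector of the angle QPS, drawn from P,
   meets the opposite side QS. *)
Definition bisector_foot (P Q S D : point) : Prop :=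
  on_segment Q S D /\ angle Q P D = angle D P S.

(* Stated as a relation; the foot D exists and is unique when P, Q, S are not
   collinear, so that l is then determined. *)
Definition bisector_length (P Q S : point) (l : R) : Prop :=
  exists D : point, bisector_foot P Q S D /\ distance P D = l.

Definition is_la (T : plane_triangle) (l : R) : Prop :=
  bisector_length (vA T) (vB T) (vC T) l.

Definition is_lb (T : plane_triangle) (l : R) : Prop :=
  bisector_length (vB T) (vC T) (vA T) l.

Definition angleC (T : plane_triangle) : R := angle (vA T) (vC T) (vB T).

Definition isometry (f : point -> point) : Prop :=
  forall P Q : point, distance (f P) (f Q) = distance P Q.

(* Vertex-respecting congruence; reflections are allowed. *)
Definition congruent (T T' : plane_triangle) : Prop :=
  exists f : point -> point,
    isometry f /\ f (vA T) = vA T' /\ f (vB T) = vB T' /\ f (vC T) = vC T'.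

(* Main.v *)
(** With [a], [b], [c] the side lengths, [l_a^2 (b + c)^2 = b c ((b + c)^2 - a^2)],
    and similarly for [l_b]. In the variables [x = (b + c - a) / (a + b - c)] and
    [y = (a + c - b) / (a + b - c)] the ratio [(l_a / l_b)^2] is a rational function
    that increases in [x] and decreases in [y], while fixing the angle at [C] amounts
    to [x y = K (1 + x + y)] with [K > 0], which makes [y] a decreasing function
    of [x]. Hence the ratio determines the triangle up to similarity, and [l_a]
    then determines its size. Existence follows from the intermediate value theorem
    along [a + b = 1], followed by a rescaling. *)

Require Import Defs.
From Stdlib Require Import Reals Lra Psatz.
Open Scope R_scope.

(** * Distances, scalar products and cross products in the plane *)

Definition cross (V P Q : point) : R :=
  (fst P - fst V) * (snd Q - snd V) - (snd P - snd V) * (fst Q - fst V).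

Lemma distance_sqr (P Q : point) :
  (distance P Q) ^ 2 = (fst P - fst Q) ^ 2 + (snd P - snd Q) ^ 2.
Proof.
  unfold distance, dist_euc. rewrite pow2_sqrt.
  - unfold Rsqr; ring.
  - apply Rplus_le_le_0_compat; apply Rle_0_sqr.
Qed.

Lemma distance_nonneg (P Q : point) : 0 <= distance P Q.
Proof. apply sqrt_pos. Qed.

Lemma distance_comm (P Q : point) : distance P Q = distance Q P.
Proof. apply distance_symm. Qed.

Lemma sqr_pos (x : R) : x <> 0 -> 0 < x ^ 2.
Proof. intro H. rewrite <- Rsqr_pow2. apply Rsqr_pos_lt; trivial. Qed.

Lemma eq_of_sqr_eq (x y : R) : 0 <= x -> 0 <= y -> x ^ 2 = y ^ 2 -> x = y.
Proof. intros Hx Hy H. apply Rsqr_inj; trivial. unfold Rsqr; nra. Qed.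

(** Lagrange's identity. It serves as Cauchy-Schwarz with an explicit defect, so a nonzero cross
    product makes the inequality strict. *)
Lemma dot_cross_sqr (V P Q : point) :
  dot V P Q ^ 2 + cross V P Q ^ 2 = (distance V P * distance V Q) ^ 2.
Proof. rewrite Rpow_mult_distr, !distance_sqr. unfold dot, cross; ring. Qed.

Lemma law_of_cosines_dot (V P Q : point) :
  distance P Q ^ 2 = distance V P ^ 2 + distance V Q ^ 2 - 2 * dot V P Q.
Proof. rewrite !distance_sqr. unfold dot; ring. Qed.

Lemma distance_pos_of_cross (V P Q : point) :
  cross V P Q <> 0 -> 0 < distance V P.
Proof.
  intro H. destruct (distance_nonneg V P) as [|E]; trivial.
  exfalso; apply H. pose proof (dot_cross_sqr V P Q) as K. rewrite <- E in K. nra.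
Qed.

Lemma cross_rotate (V P Q : point) : cross P Q V = cross V P Q.
Proof. unfold cross; ring. Qed.

Lemma cross_swap (V P Q : point) : cross V Q P = - cross V P Q.
Proof. unfold cross; ring. Qed.

Lemma cos_angle (P V Q : point) :
  0 < distance V P -> 0 < distance V Q ->
  cos (angle P V Q) = dot V P Q / (distance V P * distance V Q).
Proof.
  intros HP HQ. unfold angle. apply cos_acos.
  assert (Hm : 0 < distance V P * distance V Q) by (apply Rmult_lt_0_compat; trivial).
  pose proof (dot_cross_sqr V P Q) as K. pose proof (pow2_ge_0 (cross V P Q)).
  split.
  - apply Rmult_le_reg_r with (1 := Hm). unfold Rdiv.
    rewrite Rmult_assoc, Rinv_l by lra. nra.
  - apply Rmult_le_reg_r with (1 := Hm). unfold Rdiv.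
    rewrite Rmult_assoc, Rinv_l by lra. nra.
Qed.

Lemma collinear_of_cross_eq_0 (A B C : point) : cross A B C = 0 -> collinear A B C.
Proof.
  destruct A as [x0 y0], B as [x1 y1], C as [x2 y2]; unfold cross, collinear; simpl.
  intro H.
  destruct (Req_dec x1 x0) as [Ex|Nx]; [destruct (Req_dec y1 y0) as [Ey|Ny]|].
  - subst. destruct (Req_dec x2 x0) as [Ex|Nx].
    + subst. exists 1, 0, x0. split; [left; lra | repeat split; ring].
    + exists (y2 - y0), (x0 - x2), ((y2 - y0) * x0 + (x0 - x2) * y0).
      split; [right; lra | repeat split; ring].
  - exists (y1 - y0), (x0 - x1), ((y1 - y0) * x0 + (x0 - x1) * y0).
    split; [left; lra | repeat split; lra].
  - exists (y1 - y0), (x0 - x1), ((y1 - y0) * x0 + (x0 - x1) * y0).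
    split; [right; lra | repeat split; lra].
Qed.

Lemma cross_eq_0_of_collinear (A B C : point) : collinear A B C -> cross A B C = 0.
Proof.
  destruct A as [x0 y0], B as [x1 y1], C as [x2 y2]; unfold cross; simpl.
  intros (a & b & c & Hab & HA & HB & HC); simpl in *.
  assert (a * ((x1 - x0) * (y2 - y0) - (y1 - y0) * (x2 - x0)) = 0).
  { replace (a * _) with ((a * x1 + b * y1 - (a * x0 + b * y0)) * (y2 - y0)
      - (a * x2 + b * y2 - (a * x0 + b * y0)) * (y1 - y0)) by ring.
    rewrite HA, HB, HC; ring. }
  assert (b * ((x1 - x0) * (y2 - y0) - (y1 - y0) * (x2 - x0)) = 0).
  { replace (b * _) with ((a * x2 + b * y2 - (a * x0 + b * y0)) * (x1 - x0)
      - (a * x1 + b * y1 - (a * x0 + b * y0)) * (x2 - x0)) by ring.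
    rewrite HA, HB, HC; ring. }
  destruct (Rmult_integral _ _ H), (Rmult_integral _ _ H0); tauto.
Qed.

(** * Bisector lengths and congruence in terms of side lengths *)

(** The foot divides [Q S] in the ratio [PQ : PS], and the length then follows as in Stewart's
    theorem. This equation replaces feet and angles in all that follows. *)
Lemma bisector_length_iff (P Q S : point) (l : R) :
  cross P Q S <> 0 ->
  bisector_length P Q S l <->
  0 <= l /\
  l ^ 2 * (distance P Q + distance P S) ^ 2 =
    distance P Q * distance P S *
    ((distance P Q + distance P S) ^ 2 - distance Q S ^ 2).
Proof.
  intro Hx.
  assert (Hr : 0 < distance P Q) by (apply distance_pos_of_cross with S; trivial).
  assert (Hq : 0 < distance P S).
  { apply distance_pos_of_cross with Q. rewrite cross_swap. lra. }
  rewrite (law_of_cosines_dot P Q S).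
  pose proof (dot_cross_sqr P Q S) as K.
  pose proof (distance_sqr P Q) as Er. pose proof (distance_sqr P S) as Eq.
  assert (Hw : dot P Q S < distance P Q * distance P S).
  { assert (0 < cross P Q S ^ 2) by (apply sqr_pos; trivial).
    assert (0 < distance P Q * distance P S) by (apply Rmult_lt_0_compat; trivial). nra. }
  set (r := distance P Q) in *. set (q := distance P S) in *.
  set (w := dot P Q S) in *.
  assert (Hdiv : forall t D, D = ((1 - t) * fst Q + t * fst S, (1 - t) * snd Q + t * snd S) ->
    dot P Q D = (1 - t) * r ^ 2 + t * w /\ dot P D S = (1 - t) * w + t * q ^ 2 /\
    distance P D ^ 2 = (1 - t) ^ 2 * r ^ 2 + 2 * t * (1 - t) * w + t ^ 2 * q ^ 2).
  { intros t D ->. rewrite distance_sqr, Er, Eq. unfold w, dot; simpl. repeat split; ring. }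
  assert (Hfoot : forall t D, D = ((1 - t) * fst Q + t * fst S, (1 - t) * snd Q + t * snd S) ->
    cross P Q D = t * cross P Q S /\ cross P D S = (1 - t) * cross P Q S).
  { intros t D ->. unfold cross; simpl; split; ring. }
  split.
  - intros (D & ((t & Ht & HD) & Hang) & Hl).
    destruct (Hdiv t D HD) as (E1 & E2 & E3).
    destruct (Hfoot t D HD) as (F1 & F2).
    assert (Hd : 0 < distance P D).
    { destruct (Req_dec t 1) as [->|Nt].
      - apply distance_pos_of_cross with Q. rewrite cross_swap, F1. lra.
      - apply distance_pos_of_cross with S. rewrite F2.
        apply Rmult_integral_contrapositive_currified; lra. }
    apply (f_equal cos) in Hang. rewrite !cos_angle in Hang by trivial.
    rewrite E1, E2, Hl in Hang. rewrite Hl in Hd, E3. fold r q in Hang.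
    (* Equality of the two cosines with denominators cleared. The factor [r * q - w] is positive by
       [Hw], which leaves [t = r / (q + r)]. *)
    assert (Hbal : ((1 - t) * r - t * q) * (r * q - w) = 0).
    { apply (f_equal (fun z => z * (r * q * l))) in Hang.
      field_simplify in Hang; nra. }
    destruct (Rmult_integral _ _ Hbal) as [Hb|Hb]; [|lra].
    assert (Et : t = r / (q + r)) by (apply Rmult_eq_reg_r with (q + r); [field_simplify|]; lra).
    split; [lra|]. rewrite E3, Et. field. lra.
  - intros [Hl El].
    set (t := r / (q + r)).
    exists ((1 - t) * fst Q + t * fst S, (1 - t) * snd Q + t * snd S).
    destruct (Hdiv t _ eq_refl) as (E1 & E2 & E3).
    set (D := (_, _)) in *.
    assert (Hd : distance P D = l).
    { apply eq_of_sqr_eq; [apply distance_nonneg | trivial |].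
      apply Rmult_eq_reg_r with ((r + q) ^ 2); [|nra].
      rewrite E3, El. unfold t. field. lra. }
    split; [split|trivial].
    + exists t; split; trivial. unfold t; split.
      * apply Rlt_le, Rdiv_lt_0_compat; lra.
      * apply Rmult_le_reg_r with (q + r); [lra|]. field_simplify; lra.
    (* If [l = 0], the length equation would force [w = - (r * q)], that is, a straight angle at
       [P]. *)
    + assert (0 < l).
      { destruct Hl as [|<-]; trivial. exfalso.
        assert (- (r * q) < w).
        { assert (0 < cross P Q S ^ 2) by (apply sqr_pos; trivial).
          assert (0 < r * q) by (apply Rmult_lt_0_compat; trivial). nra. }
        assert (0 < r * q) by (apply Rmult_lt_0_compat; trivial). nra. }
      unfold angle. rewrite E1, E2, Hd. fold r q. f_equal. unfold t. field. lra.
Qed.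

Lemma congruent_of_SAS (T T' : plane_triangle) :
  distance (vC T) (vA T) = distance (vC T') (vA T') ->
  distance (vC T) (vB T) = distance (vC T') (vB T') ->
  dot (vC T) (vA T) (vB T) = dot (vC T') (vA T') (vB T') ->
  congruent T T'.
Proof.
  destruct T as [A B C N], T' as [A' B' C' N']; simpl. intros HA HB HD.
  assert (Hd : cross C A B <> 0).
  { intro H. apply N, collinear_of_cross_eq_0. rewrite <- H. unfold cross; ring. }
  apply (f_equal (fun z => z ^ 2)) in HA. rewrite !distance_sqr in HA.
  apply (f_equal (fun z => z ^ 2)) in HB. rewrite !distance_sqr in HB.
  unfold congruent; simpl.
  (* Send a point to the one with the same affine coordinates in the other
     triangle: distances only depend on the Gram matrix of the frame. *)
  exists (fun P =>
    (fst C' + cross C P B / cross C A B * (fst A' - fst C')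
            + cross C A P / cross C A B * (fst B' - fst C'),
     snd C' + cross C P B / cross C A B * (snd A' - snd C')
            + cross C A P / cross C A B * (snd B' - snd C'))).
  assert (Haa : cross C A A = 0) by (unfold cross; ring).
  assert (Hbb : cross C B B = 0) by (unfold cross; ring).
  assert (Hcb : cross C C B = 0) by (unfold cross; ring).
  assert (Hac : cross C A C = 0) by (unfold cross; ring).
  repeat split.
  - intros P Q. apply eq_of_sqr_eq; try apply distance_nonneg.
    rewrite !distance_sqr; simpl.
    set (s := (cross C P B - cross C Q B) / cross C A B).
    set (t := (cross C A P - cross C A Q) / cross C A B).
    transitivity (s ^ 2 * ((fst C' - fst A') ^ 2 + (snd C' - snd A') ^ 2)
      + 2 * s * t * dot C' A' B'
      + t ^ 2 * ((fst C' - fst B') ^ 2 + (snd C' - snd B') ^ 2)).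
    + unfold s, t, dot; field; trivial.
    + rewrite <- HA, <- HB, <- HD.
      unfold s, t, dot. clear - Hd. unfold cross in *. field. trivial.
  - rewrite Haa. destruct A'; simpl; f_equal; field; trivial.
  - rewrite Hbb. destruct B'; simpl; f_equal; field; trivial.
  - rewrite Hcb, Hac. destruct C'; simpl; f_equal; field; trivial.
Qed.

(** * Monotonicity and injectivity of the bisector ratio *)

(* The square of [l_a / l_b] in the variables [x = (b + c - a) / (a + b - c)] and
   [y = (a + c - b) / (a + b - c)]. *)
Definition ratio (x y : R) : R :=
  (x * (x + 1) * (2 * y + x + 1) ^ 2) / (y * (y + 1) * (2 * x + y + 1) ^ 2).

Lemma frac_lt (n d n' d' : R) : 0 < d -> 0 < d' -> n * d' < n' * d -> n / d < n' / d'.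
Proof.
  intros Hd Hd' H. apply Rmult_lt_reg_r with (d * d'); [apply Rmult_lt_0_compat; trivial|].
  field_simplify; lra.
Qed.

(** Both [x * (x + 1) / (2 * x + y + 1) ^ 2] and [(2 * y + x + 1) ^ 2] increase in [x]; [H1] and
    [H2] state this without division. *)
Lemma ratio_increasing_l (x x' y : R) :
  0 < x -> x < x' -> 0 < y -> ratio x y < ratio x' y.
Proof.
  intros Hx Hxx Hy. unfold ratio.
  assert (H1 : x * (x + 1) * (2 * x' + y + 1) ^ 2 < x' * (x' + 1) * (2 * x + y + 1) ^ 2).
  { apply Rlt_0_minus.
    replace (_ - _) with ((x' - x) * (4 * x * x' * y + (y + 1) ^ 2 * (x + x' + 1))) by ring.
    apply Rmult_lt_0_compat; [lra|].
    apply Rplus_lt_0_compat; repeat apply Rmult_lt_0_compat; lra. }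
  assert (H2 : (2 * y + x + 1) ^ 2 < (2 * y + x' + 1) ^ 2) by nra.
  apply frac_lt.
  - repeat apply Rmult_lt_0_compat; lra.
  - repeat apply Rmult_lt_0_compat; lra.
  - replace (x * (x + 1) * (2 * y + x + 1) ^ 2 * (y * (y + 1) * (2 * x' + y + 1) ^ 2))
      with (y * (y + 1) * (x * (x + 1) * (2 * x' + y + 1) ^ 2 * (2 * y + x + 1) ^ 2)) by ring.
    replace (x' * (x' + 1) * (2 * y + x' + 1) ^ 2 * (y * (y + 1) * (2 * x + y + 1) ^ 2))
      with (y * (y + 1) * (x' * (x' + 1) * (2 * x + y + 1) ^ 2 * (2 * y + x' + 1) ^ 2)) by ring.
    apply Rmult_lt_compat_l; [apply Rmult_lt_0_compat; lra|].
    apply Rmult_gt_0_lt_compat; trivial; try (repeat apply Rmult_lt_0_compat; lra).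
Qed.

Lemma ratio_inv (x y : R) : 0 < x -> 0 < y -> ratio x y = / ratio y x.
Proof. intros Hx Hy. unfold ratio. field. repeat split; lra. Qed.

(** Swapping the variables inverts the ratio, so monotonicity in the first variable carries over,
    reversed. *)
Lemma ratio_decreasing_r (x y y' : R) :
  0 < x -> 0 < y -> y < y' -> ratio x y' < ratio x y.
Proof.
  intros Hx Hy Hyy. rewrite (ratio_inv x y), (ratio_inv x y') by lra.
  apply Rinv_lt_contravar; [|apply ratio_increasing_l; trivial].
  unfold ratio. apply Rmult_lt_0_compat; apply Rdiv_lt_0_compat;
    repeat apply Rmult_lt_0_compat; lra.
Qed.

(* For a fixed angle at [C], [x * y = K * (1 + x + y)] with [K = tan (C / 2) ^ 2], so
   [y] decreases when [x] increases. *)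
Lemma ratio_inj (K x y x' y' : R) :
  0 < K -> 0 < x -> 0 < y -> 0 < x' -> 0 < y' ->
  x * y = K * (1 + x + y) -> x' * y' = K * (1 + x' + y') ->
  ratio x y = ratio x' y' -> x = x' /\ y = y'.
Proof.
  intros HK.
  assert (Hlt : forall x y x' y', 0 < x -> 0 < y -> 0 < x' -> 0 < y' ->
    x * y = K * (1 + x + y) -> x' * y' = K * (1 + x' + y') -> x < x' ->
    y' < y /\ ratio x y < ratio x' y').
  { clear x y x' y'. intros x y x' y' Hx Hy Hx' Hy' E E' Hxx.
    (* The constraint is the hyperbola [(x - K) * (y - K) = K * (K + 1)], and positivity selects the
       branch where both coordinates exceed [K]. *)
    assert (K < x) by nra. assert (K < y') by nra.
    assert (y' < y).
    { assert ((x - K) * (y - K) = (x' - K) * (y' - K)) by nra.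
      assert ((x - K) * (y' - K) < (x' - K) * (y' - K)) by (apply Rmult_lt_compat_r; lra).
      nra. }
    split; trivial.
    apply Rlt_trans with (ratio x' y);
      [apply ratio_increasing_l | apply ratio_decreasing_r]; trivial. }
  intros Hx Hy Hx' Hy' E E' R.
  destruct (Rtotal_order x x') as [H|[H|H]].
  - destruct (Hlt x y x' y'); trivial; lra.
  - subst x'. split; trivial.
    assert (K < x) by nra. apply Rmult_eq_reg_l with (x - K); nra.
  - destruct (Hlt x' y' x y); trivial; lra.
Qed.

(** * Uniqueness of the side lengths *)

(** The law of cosines gives [c ^ 2 - (a - b) ^ 2 = 2 * a * b * (1 - k)] and [(a + b) ^ 2 - c ^ 2 =
    2 * a * b * (1 + k)], both positive. *)
Lemma strict_triangle_ineq (a b c k : R) :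
  0 < a -> 0 < b -> 0 < c -> -1 < k < 1 -> c ^ 2 = a ^ 2 + b ^ 2 - 2 * (a * b * k) ->
  0 < b + c - a /\ 0 < a + c - b /\ 0 < a + b - c.
Proof.
  intros Ha Hb Hc Hk E. assert (0 < a * b) by (apply Rmult_lt_0_compat; trivial).
  repeat split; nra.
Qed.

Lemma bisectors_determine_sides (la lb k a b c a' b' c' : R) :
  0 < la -> 0 < lb -> -1 < k < 1 ->
  0 < a -> 0 < b -> 0 < c -> 0 < a' -> 0 < b' -> 0 < c' ->
  c ^ 2 = a ^ 2 + b ^ 2 - 2 * (a * b * k) ->
  c' ^ 2 = a' ^ 2 + b' ^ 2 - 2 * (a' * b' * k) ->
  la ^ 2 * (b + c) ^ 2 = b * c * ((b + c) ^ 2 - a ^ 2) ->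
  lb ^ 2 * (a + c) ^ 2 = a * c * ((a + c) ^ 2 - b ^ 2) ->
  la ^ 2 * (b' + c') ^ 2 = b' * c' * ((b' + c') ^ 2 - a' ^ 2) ->
  lb ^ 2 * (a' + c') ^ 2 = a' * c' * ((a' + c') ^ 2 - b' ^ 2) ->
  a = a' /\ b = b'.
Proof.
  intros Hla Hlb Hk Ha Hb Hc Ha' Hb' Hc' E E' EA EB EA' EB'.
  (* With [k = cos C], this is [tan (C / 2) ^ 2]. *)
  set (K := (1 - k) / (1 + k)).
  assert (HK : 0 < K) by (apply Rdiv_lt_0_compat; lra).
  (* Here [z = a + b - c] is the scale and [x], [y] give the shape. Once the shape is known, the
     equation for [la] determines [z]. *)
  assert (Hcoord : forall a b c, 0 < a -> 0 < b -> 0 < c ->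
    c ^ 2 = a ^ 2 + b ^ 2 - 2 * (a * b * k) ->
    la ^ 2 * (b + c) ^ 2 = b * c * ((b + c) ^ 2 - a ^ 2) ->
    lb ^ 2 * (a + c) ^ 2 = a * c * ((a + c) ^ 2 - b ^ 2) ->
    exists x y z, 0 < x /\ 0 < y /\ 0 < z /\ x * y = K * (1 + x + y) /\
      a = z * (y + 1) / 2 /\ b = z * (x + 1) / 2 /\
      la ^ 2 * (2 * x + y + 1) ^ 2 = z ^ 2 * ((x + 1) * (x + y) * x * (x + y + 1)) /\
      ratio x y = la ^ 2 / lb ^ 2).
  { clear - Hla Hlb Hk. intros a b c Ha Hb Hc E EA EB.
    destruct (strict_triangle_ineq a b c k) as (Hx & Hy & Hz); trivial.
    remember (a + b - c) as z eqn:Ez.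
    exists ((b + c - a) / z), ((a + c - b) / z), z.
    set (x := (b + c - a) / z). set (y := (a + c - b) / z).
    assert (0 < x) by (apply Rdiv_lt_0_compat; trivial).
    assert (0 < y) by (apply Rdiv_lt_0_compat; trivial).
    assert (Exz : z * x = b + c - a) by (unfold x; field; lra).
    assert (Eyz : z * y = a + c - b) by (unfold y; field; lra).
    assert (Ea : a = z * (y + 1) / 2) by lra.
    assert (Eb : b = z * (x + 1) / 2) by lra.
    assert (Ec : c = z * (x + y) / 2) by lra.
    clear Exz Eyz Ez.
    clearbody x y. subst a b c.
    assert (Hz2 : 0 < z ^ 2) by (apply pow_lt; trivial).
    assert (FA : la ^ 2 * (2 * x + y + 1) ^ 2 = z ^ 2 * ((x + 1) * (x + y) * x * (x + y + 1))).
    { apply Rmult_eq_reg_l with (z ^ 2 / 4); [|lra].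
      transitivity (la ^ 2 * (z * (x + 1) / 2 + z * (x + y) / 2) ^ 2); [field|].
      rewrite EA. field. }
    assert (FB : lb ^ 2 * (2 * y + x + 1) ^ 2 = z ^ 2 * ((y + 1) * (x + y) * y * (x + y + 1))).
    { apply Rmult_eq_reg_l with (z ^ 2 / 4); [|lra].
      transitivity (lb ^ 2 * (z * (y + 1) / 2 + z * (x + y) / 2) ^ 2); [field|].
      rewrite EB. field. }
    do 3 (split; [assumption|]). split; [|do 2 (split; [reflexivity|]); split; trivial].
    (* The law of cosines in the new variables: [z ^ 2 * x * y = 2 * a * b * (1 - k)] and [z ^ 2 *
       (1 + x + y) = 2 * a * b * (1 + k)]. *)
    - unfold K. apply Rmult_eq_reg_r with (z ^ 2 * (1 + k)); [|nra].
      replace ((1 - k) / (1 + k) * (1 + x + y) * (z ^ 2 * (1 + k)))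
        with ((1 - k) * (1 + x + y) * z ^ 2) by (field; lra).
      nra.
    (* Quotient of [FA] by [FB]; the common factor [z ^ 2 * (x + y) * (x + y + 1)] cancels. *)
    - unfold ratio.
      assert (0 < lb ^ 2) by (apply pow_lt; trivial).
      assert (0 < z ^ 2 * ((x + y) * (x + y + 1))) by (repeat apply Rmult_lt_0_compat; lra).
      apply Rmult_eq_reg_r with
        (z ^ 2 * ((x + y) * (x + y + 1)) * (lb ^ 2 * (y * (y + 1) * (2 * x + y + 1) ^ 2))).
      + transitivity ((z ^ 2 * ((x + 1) * (x + y) * x * (x + y + 1)))
          * (lb ^ 2 * (2 * y + x + 1) ^ 2)); [field; repeat split; lra|].
        rewrite FB, <- FA. field; lra.
      + apply Rgt_not_eq. repeat apply Rmult_lt_0_compat; lra. }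
  destruct (Hcoord a b c) as (x & y & z & Hx & Hy & Hz & F & Ea & Eb & FA & FR); trivial.
  destruct (Hcoord a' b' c') as (x' & y' & z' & Hx' & Hy' & Hz' & F' & Ea' & Eb' & FA' & FR');
    trivial.
  destruct (ratio_inj K x y x' y'); trivial; [congruence|]. subst x' y'.
  assert (z = z').
  { apply eq_of_sqr_eq; try lra.
    apply Rmult_eq_reg_r with ((x + 1) * (x + y) * x * (x + y + 1)); [congruence|].
    apply Rgt_not_eq. repeat apply Rmult_lt_0_compat; lra. }
  subst z'. split; congruence.
Qed.

(** * Existence of the side lengths *)

(** The last equation says that the squared bisectors are in the ratio [p : q], after cancelling
    [c * (a + b + c)]. It is homogeneous in the sides, which allows the normalisation [a = u],
    [b = 1 - u], [c = sqrt (s u)]. *)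
Lemma sides_with_bisector_ratio (p q k : R) :
  0 < p -> 0 < q -> -1 < k < 1 ->
  exists a b c, 0 < a /\ 0 < b /\ 0 < c /\
    c ^ 2 = a ^ 2 + b ^ 2 - 2 * (a * b * k) /\
    q * (b * (b + c - a) * (a + c) ^ 2) = p * (a * (a + c - b) * (b + c) ^ 2).
Proof.
  intros Hp Hq Hk.
  set (s := fun u => u ^ 2 + (1 - u) ^ 2 - 2 * (u * (1 - u) * k)).
  assert (Hs : forall u, 0 < s u).
  { intro u. unfold s.
    replace (_ - _) with (((1 - k) + (1 + k) * (2 * u - 1) ^ 2) / 2) by field.
    pose proof (pow2_ge_0 (2 * u - 1)). nra. }
  set (G := fun u => p * (u * (u + sqrt (s u) - (1 - u)) * ((1 - u) + sqrt (s u)) ^ 2)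
     - q * ((1 - u) * ((1 - u) + sqrt (s u) - u) * (u + sqrt (s u)) ^ 2)).
  assert (HG : continuity G).
  { assert (Cs : continuity (fun u => sqrt (s u))).
    { intro u. apply (continuity_pt_comp s sqrt).
      - unfold s; reg.
      - apply continuity_pt_sqrt, Rlt_le, Hs. }
    (* With the square root abstracted to an arbitrary continuous function, [reg] has only a
       polynomial expression to handle. *)
    unfold G. clearbody s. set (r := fun u => sqrt (s u)) in *.
    change (continuity (fun u => p * (u * (u + r u - (1 - u)) * ((1 - u) + r u) ^ 2)
     - q * ((1 - u) * ((1 - u) + r u - u) * (u + r u) ^ 2))).
    clearbody r. reg. }
  assert (S0 : sqrt (s 0) = 1).
  { replace (s 0) with 1 by (unfold s; ring). apply sqrt_1. }
  assert (S1 : sqrt (s 1) = 1).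
  { replace (s 1) with 1 by (unfold s; ring). apply sqrt_1. }
  (* At the degenerate ends, [G 0 = - 2 * q] and [G 1 = 2 * p], so the zero is interior. *)
  destruct (IVT G 0 1 HG) as (u & Hu & Gu).
  - lra.
  - unfold G. rewrite S0. lra.
  - unfold G. rewrite S1. lra.
  - assert (u <> 0) by (intros ->; unfold G in Gu; rewrite S0 in Gu; lra).
    assert (u <> 1) by (intros ->; unfold G in Gu; rewrite S1 in Gu; lra).
    exists u, (1 - u), (sqrt (s u)).
    repeat split; try lra.
    + apply sqrt_lt_R0, Hs.
    + rewrite pow2_sqrt by apply Rlt_le, Hs. reflexivity.
    + unfold G in Gu. lra.
Qed.

Lemma sides_with_bisectors (la lb k : R) :
  0 < la -> 0 < lb -> -1 < k < 1 ->
  exists a b c, 0 < a /\ 0 < b /\ 0 < c /\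
    c ^ 2 = a ^ 2 + b ^ 2 - 2 * (a * b * k) /\
    la ^ 2 * (b + c) ^ 2 = b * c * ((b + c) ^ 2 - a ^ 2) /\
    lb ^ 2 * (a + c) ^ 2 = a * c * ((a + c) ^ 2 - b ^ 2).
Proof.
  intros Hla Hlb Hk.
  destruct (sides_with_bisector_ratio (la ^ 2) (lb ^ 2) k) as
    (a & b & c & Ha & Hb & Hc & E & ER); try apply pow_lt; trivial.
  destruct (strict_triangle_ineq a b c k) as (Hx & Hy & Hz); trivial.
  set (Q := b * c * ((b + c - a) * (a + b + c))).
  assert (HQ : 0 < Q) by (repeat apply Rmult_lt_0_compat; lra).
  (* Bisectors scale linearly with the sides; [r] is the factor that makes the bisector from [A]
     equal to [la]. *)
  set (r := la * (b + c) / sqrt Q).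
  assert (Hr : 0 < r).
  { apply Rdiv_lt_0_compat; [apply Rmult_lt_0_compat; lra | apply sqrt_lt_R0; trivial]. }
  assert (Er : r ^ 2 * Q = la ^ 2 * (b + c) ^ 2).
  { rewrite <- (pow2_sqrt Q) at 1 by lra. unfold r. field.
    apply Rgt_not_eq, sqrt_lt_R0; trivial. }
  exists (r * a), (r * b), (r * c).
  do 3 (split; [apply Rmult_lt_0_compat; trivial|]). repeat split.
  - transitivity (r ^ 2 * c ^ 2); [ring|]. rewrite E; ring.
  - transitivity (r ^ 2 * (la ^ 2 * (b + c) ^ 2)); [ring|].
    rewrite <- Er; unfold Q; ring.
  (* This factor makes the left side of [ER] appear, and [ER] turns the equation for [lb] into the
     one for [la]. *)
  - apply Rmult_eq_reg_r with (b * (b + c - a));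
      [|apply Rgt_not_eq, Rmult_lt_0_compat; trivial].
    transitivity (r ^ 2 * (lb ^ 2 * (b * (b + c - a) * (a + c) ^ 2))); [ring|].
    rewrite ER.
    transitivity (r ^ 2 * (a * (a + c - b)) * (la ^ 2 * (b + c) ^ 2)); [ring|].
    rewrite <- Er; unfold Q; ring.
Qed.

(** * From side lengths back to triangles *)

Theorem mainTheorem3 (l1 l2 : R) (Hl2 : 0 < l2) (Hl : l2 <= l1)
    (theta : R) (Htheta : 0 < theta < PI) :
  exists T : plane_triangle,
    (is_la T l2 /\ is_lb T l1 /\ angleC T = theta) /\
    (forall T' : plane_triangle,
       is_la T' l2 /\ is_lb T' l1 /\ angleC T' = theta -> congruent T T').
Proof.
  assert (Hl1 : 0 < l1) by lra.
  assert (Hsin : 0 < sin theta) by (apply sin_gt_0; lra).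
  pose proof (sin2_cos2 theta) as Hsc. unfold Rsqr in Hsc.
  assert (Hk : -1 < cos theta < 1) by (split; nra).
  destruct (sides_with_bisectors l2 l1 (cos theta)) as
    (a & b & c & Ha & Hb & Hc & E & EA & EB); trivial.
  set (C := (0, 0) : point). set (A := (b, 0) : point).
  set (B := (a * cos theta, a * sin theta) : point).
  assert (Hx : cross A B C <> 0).
  { replace (cross A B C) with (b * (a * sin theta)) by (unfold cross; simpl; ring).
    apply Rgt_not_eq. repeat apply Rmult_lt_0_compat; trivial. }
  assert (Hcol : ~ collinear A B C) by (intro H; apply Hx, cross_eq_0_of_collinear, H).
  assert (Dca : distance C A = b).
  { apply eq_of_sqr_eq; [apply distance_nonneg | lra | rewrite distance_sqr; simpl; ring]. }
  assert (Dcb : distance C B = a).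
  { apply eq_of_sqr_eq; [apply distance_nonneg | lra | rewrite distance_sqr; simpl].
    transitivity (a ^ 2 * (sin theta * sin theta + cos theta * cos theta)); [ring|].
    rewrite Hsc; ring. }
  assert (Ddot : dot C A B = a * b * cos theta) by (unfold dot; simpl; ring).
  assert (Dab : distance A B = c).
  { apply eq_of_sqr_eq; [apply distance_nonneg | lra |].
    rewrite (law_of_cosines_dot C), Dca, Dcb, Ddot, E. ring. }
  exists (Triangle A B C Hcol). split.
  - unfold is_la, is_lb, angleC; simpl. repeat split.
    + apply bisector_length_iff; trivial.
      rewrite (distance_comm A C), (distance_comm B C), Dab, Dca, Dcb.
      split; [lra|]. rewrite (Rplus_comm c b), EA. ring.
    + apply bisector_length_iff; [rewrite cross_rotate; trivial|].
      rewrite (distance_comm B C), (distance_comm B A), Dab, Dca, Dcb.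
      split; [lra|]. rewrite EB. ring.
    + unfold angle. rewrite Dca, Dcb, Ddot.
      replace (a * b * cos theta / (b * a)) with (cos theta) by (field; lra).
      apply acos_cos; lra.
  - intros [A' B' C' Hcol'] (HA & HB & HC).
    unfold is_la, is_lb, angleC in *; simpl in *.
    assert (Hx' : cross A' B' C' <> 0) by (intro H; apply Hcol', collinear_of_cross_eq_0, H).
    assert (Pab : 0 < distance A' B') by (apply distance_pos_of_cross with C'; trivial).
    assert (Pcb : 0 < distance B' C').
    { apply distance_pos_of_cross with A'. rewrite cross_rotate; trivial. }
    assert (Pca : 0 < distance C' A').
    { apply distance_pos_of_cross with B'. rewrite 2!cross_rotate; trivial. }
    apply bisector_length_iff in HA; [|trivial].
    apply bisector_length_iff in HB; [|rewrite cross_rotate; trivial].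
    destruct HA as [_ EA'], HB as [_ EB'].
    (* The angle condition as a scalar product, the form used by both the law of cosines and
       [congruent_of_SAS]. *)
    assert (Ddot' : dot C' A' B' = distance B' C' * distance C' A' * cos theta).
    { rewrite <- HC, cos_angle, (distance_comm C' B'); trivial; [field; lra|].
      rewrite distance_comm; trivial. }
    pose proof (law_of_cosines_dot C' A' B') as E'. rewrite Ddot', (distance_comm C' B') in E'.
    rewrite (distance_comm A' C') in EA'. rewrite (distance_comm B' A') in EB'.
    destruct (bisectors_determine_sides l2 l1 (cos theta) a b c
      (distance B' C') (distance C' A') (distance A' B')) as [Ea Eb]; trivial.
    + rewrite E'. ring.
    + rewrite (Rplus_comm (distance C' A')), EA'. ring.
    + apply congruent_of_SAS; simpl.
      * congruence.
      * rewrite (distance_comm C' B'). congruence.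
      * rewrite Ddot, Ddot'. congruence.
Qed.
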